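(* Let $G$ be a finite simple graph with non-empty edge set, let $K$ be a field and let $A(G)=K[E_G]/I(G)$ be the Eulerian Artinian algebra of $G$. Then the socle of $A(G)$ is generated by residues of monomials, i.e. by classes $\mathbf{t}^\alpha+I(G)$ of monomials $\mathbf{t}^\alpha\in K[E_G]$.
   Context: $G$ is a finite simple undirected graph with vertex set $V_G$ and non-empty edge set $E_G$ (each edge is a 2-element subset of $V_G$); $K$ is any field. $K[E_G]=K[t_e : e\in E_G]$ is the standard graded polynomial ring with one variable per edge, with irrelevant ideal $\mathfrak m=(t_e: e\in E_G)$. For $J\subseteq E_G$, $\mathbf{t}_J=\prod_{e\in J}t_e$. For $C\subseteq E_G$ and $v\in V_G$, $\deg_C(v)$ is the number of edges of $C$ containing $v$. $C$ is called Eulerian if $\deg_C(v)$ is even for every $v\in V_G$ (the empty set is Eulerian). An Eulerian binomial is $\mathbf{t}_J-\mathbf{t}_L$ where $J,L\subseteq E_G$ are non-empty, $J\cap L=\emptyset$, $|J|=|L|$ and $J\cup L$ is Eulerian. $\mathscr{E}$ denotes the set of Eulerian binomials. $I(G)$ is the ideal of $K[E_G]$ generated by $\mathscr{E}\cup\{t_e^2 : e\in E_G\}$, and $A(G)=K[E_G]/I(G)$ is the Eulerian Artinian algebra associated to $G$. The socle of a graded $K[E_G]$-module $M$ is $\{u\in M : \mathfrak m u=0\}$. *)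

(* Defs.v *)
From HB Require Import structures.
From mathcomp Require Import all_boot all_order all_algebra.
From mathcomp Require Import boolp classical_sets.
From mathcomp Require Export mpoly.

Set Implicit Arguments.
Unset Strict Implicit.
Unset Printing Implicit Defensive.

Import GRing.Theory.

Local Open Scope ring_scope.
Local Open Scope quotient_scope.
Local Open Scope classical_set_scope.

Definition generated (R : pzRingType) (M : lmodType R) (S : set M) : set M :=
  [set x | exists s : seq (R * M),
    (forall c, c \in s -> S c.2) /\ x = \sum_(c <- s) c.1 *: c.2].

Arguments generated {R} M S.

(* Ideals are submodules of the regular module R^o. *)
Definition ideal_generated (R : nzRingType) (S : set R) : set R :=
  generated R^o S.

Definition irrelevant_ideal (n : nat) (K : fieldType) : set {mpoly K[n]} :=
  ideal_generated [set 'X_i | i in [set: 'I_n]].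

Definition socle (n : nat) (K : fieldType) (M : lmodType {mpoly K[n]}) :
    set M :=
  [set u | forall p, irrelevant_ideal p -> p *: u = 0].

Arguments socle {n K} M.

Record sgraph (V : finType) := SGraph {
  edges : {set {set V}};
  card_edges : forall e, e \in edges -> #|e| = 2%N
}.

Section Edges.

Variables (V : finType) (G : sgraph V).

Definition edge : finType := {e : {set V} | e \in edges G}.

Definition edge_deg (C : {set edge}) (v : V) : nat :=
  #|[pred e in C | v \in val e]|.

Definition eulerian (C : {set edge}) : Prop :=
  forall v : V, ~~ odd (edge_deg C v).

End Edges.

(* K[E_G]: the edge e corresponds to the variable of index enum_rank e. *)
Notation edge_ring G K := {mpoly K[#|edge G|]}.

Section EulerianAlgebra.

Variables (V : finType) (G : sgraph V) (K : fieldType).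

Local Notation R := (edge_ring G K).

Definition edge_var (e : edge G) : R := 'X_(enum_rank e).

Definition edge_prod (J : {set edge G}) : R := \prod_(e in J) edge_var e.

Definition eulerian_binomials : set R :=
  [set f | exists J L : {set edge G},
    [/\ J != finset.set0, L != finset.set0, J :&: L = finset.set0, #|J| = #|L|
      & eulerian (J :|: L)] /\ f = edge_prod J - edge_prod L].

Definition edge_squares : set R := range (fun e => edge_var e ^+ 2).

Definition eulerian_ideal : set R :=
  ideal_generated (eulerian_binomials `|` edge_squares).

(* The library quotient takes a boolean predicate that is a proper ideal. *)
Definition in_eulerian_ideal (p : R) : bool := `[< eulerian_ideal p >].

Lemma eulerian_ideal_closed : idealr_closed in_eulerian_ideal.
Proof.
split.
- by apply/asboolP; exists [::]; split=> //; rewrite big_nil.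
- apply/asboolPn => -[s [sP /(congr1 (meval (fun=> 0)))]].
  rewrite meval1 raddf_sum /= big_seq big1 => [/eqP|[a p] /sP /= Sp].
    by rewrite oner_eq0.
  rewrite -[X in meval _ X]/(a * p) mevalM.
  suff -> : meval (fun=> 0) p = 0 by rewrite mulr0.
  have prod0 (J : {set edge G}) :
      J != finset.set0 -> meval (fun=> 0) (edge_prod J) = 0.
    case/finset.set0Pn => e eJ.
    by rewrite rmorph_prod (bigD1 e) //= mevalXU mul0r.
  case: Sp => [[J [L [[J0 L0 _ _ _] ->]]]|[e _ <-]].
    by rewrite mevalB !prod0 // subr0.
  by rewrite mevalM mevalXU mul0r.
- move=> a u v /asboolP[s [sP ->]] /asboolP[r [rP ->]]; apply/asboolP.
  exists ([seq (a * c.1, c.2) | c <- s] ++ r); split=> [c|].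
    by rewrite mem_cat => /orP[/mapP[d /sP ? ->]|/rP].
  rewrite big_cat big_map mulr_sumr; congr (_ + _).
  by apply: eq_bigr => c _; exact: mulrA.
Qed.

HB.instance Definition _ :=
  isIdealr.Build R in_eulerian_ideal eulerian_ideal_closed.

Definition eulerian_idealr : idealr R := in_eulerian_ideal.

Definition eulerian_algebra : Type := {ideal_quot eulerian_idealr}.

HB.instance Definition _ := GRing.ComNzRing.on eulerian_algebra.

Definition residue (p : R) : eulerian_algebra :=
  \pi_{ideal_quot eulerian_idealr} p.

Definition eulerian_scale (p : R) (u : eulerian_algebra) : eulerian_algebra :=
  residue p * u.

Lemma eulerian_scaleA p q u :
  eulerian_scale p (eulerian_scale q u) = eulerian_scale (p * q) u.
Proof. by rewrite /eulerian_scale /residue rmorphM mulrA. Qed.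

Lemma eulerian_scale1 : left_id 1 eulerian_scale.
Proof. by move=> u; rewrite /eulerian_scale /residue rmorph1 mul1r. Qed.

Lemma eulerian_scaleDr : right_distributive eulerian_scale +%R.
Proof. by move=> p u v; rewrite /eulerian_scale mulrDr. Qed.

Lemma eulerian_scaleDl u : {morph eulerian_scale^~ u : p q / p + q}.
Proof. by move=> p q; rewrite /eulerian_scale /residue rmorphD mulrDl. Qed.

HB.instance Definition _ := GRing.Zmodule_isLmodule.Build R eulerian_algebra
  eulerian_scaleA eulerian_scale1 eulerian_scaleDr eulerian_scaleDl.

End EulerianAlgebra.

(* Main.v *)
(** Grade monomials by their total degree together with the parities of the
    degrees of all vertices in the multigraph that they describe. The ideal
    I(G) is homogeneous for this grading, and any two monomials of the same
    grade are congruent modulo I(G), so every graded piece of A(G) is spanned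
    by the residue of one monomial. Multiplication by a variable shifts
    grades injectively, hence the graded components of a socle element are
    again in the socle. *)
Require Import Defs.
From HB Require Import structures.
From mathcomp Require Import all_boot all_order all_algebra.
From mathcomp Require Import boolp classical_sets.
From mathcomp Require Import zify.

Set Implicit Arguments.
Unset Strict Implicit.
Unset Printing Implicit Defensive.

Import GRing.Theory.

Local Open Scope ring_scope.

Lemma exists_subset_card (T : finType) (A : {set T}) k :
  (k <= #|A|)%N -> exists2 B : {set T}, B \subset A & #|B| = k.
Proof.
move=> /card_geqP[s [s_uniq s_size sA]]; exists [set:: s]%SET.
  by apply/fintype.subsetP => x; rewrite inE; exact: sA.
by rewrite cardsE -s_size; exact/card_uniqP.
Qed.

(** * Homogeneous components of a polynomial along a map on monomials *)

Section FiberPart.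

Variables (n : nat) (K : comNzRingType) (T : eqType) (k : 'X_{1..n} -> T).

Local Notation R := {mpoly K[n]}.

Definition fiber_part (c : T) (p : R) : R :=
  \sum_(m <- msupp p | k m == c) p@_m *: 'X_[m].

Lemma mcoeff_fiber_part c p m :
  (fiber_part c p)@_m = if k m == c then p@_m else 0.
Proof.
rewrite /fiber_part raddf_sum /= (eq_bigr (fun i => p@_i * (i == m)%:R)); last first.
  by move=> i _; rewrite mcoeffZ mcoeffX.
have [m_p|m_p] := boolP (m \in msupp p); last first.
  rewrite big_seq_cond big1 => [|i /andP[i_p _]].
    by rewrite (memN_msupp_eq0 m_p) if_same.
  by case: eqP => [im|_]; [rewrite -im i_p in m_p | rewrite mulr0].
rewrite big_mkcond (bigD1_seq m) ?msupp_uniq //= eqxx mulr1 big1 ?addr0 // => i.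
by move=> /negPf->; rewrite mulr0 if_same.
Qed.

Lemma fiber_part_is_linear c : linear (fiber_part c).
Proof.
move=> a p q; apply/mpolyP => m.
rewrite mcoeffD mcoeffZ !mcoeff_fiber_part mcoeffD mcoeffZ.
by case: ifP; rewrite // mulr0 addr0.
Qed.

HB.instance Definition _ c :=
  GRing.isLinear.Build K R R _ (fiber_part c) (fiber_part_is_linear c).

Lemma fiber_partX c m :
  fiber_part c 'X_[m] = if k m == c then 'X_[m] else 0.
Proof.
apply/mpolyP => m'; rewrite mcoeff_fiber_part (fun_if (mcoeff m')).
rewrite !mcoeffX mcoeff0; case: (eqVneq m m') => [->//|_].
by rewrite !if_same.
Qed.

Lemma fiber_part_sum p :
  p = \sum_(c <- undup [seq k m | m <- msupp p]) fiber_part c p.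
Proof.
apply/mpolyP => m; rewrite raddf_sum /=.
under eq_bigr do rewrite mcoeff_fiber_part.
have [m_p|m_p] := boolP (m \in msupp p); last first.
  by rewrite (memN_msupp_eq0 m_p) big1 // => c _; rewrite if_same.
rewrite (bigD1_seq (k m)) ?undup_uniq ?mem_undup ?map_f //= eqxx big1 ?addr0 //.
by move=> c; rewrite eq_sym => /negPf->.
Qed.

(** Translation by [a] neither merges nor splits fibres of [k], so multiplication by ['X_[a]]
    carries one fibre of [p] exactly onto one fibre of the product. *)
Lemma fiber_partXM a m p :
    (forall m1 m2, (k (a + m1)%MM == k (a + m2)%MM) = (k m1 == k m2)) ->
  fiber_part (k (a + m)%MM) ('X_[a] * p) = 'X_[a] * fiber_part (k m) p.
Proof.
move=> ka; rewrite [p in LHS]mpolyE [p in RHS]mpolyE mulr_sumr !linear_sum /=.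
rewrite mulr_sumr; apply: eq_bigr => m' _.
rewrite -scalerAr -mpolyXD !linearZ /= !fiber_partX ka -scalerAr.
by case: ifP; rewrite ?mulr0 // mpolyXD.
Qed.

End FiberPart.

(** * Closure properties of generated submodules *)

Section Generated.

Variables (R : pzRingType) (M : lmodType R) (S : set M).

Lemma generated0 : generated M S 0.
Proof. by exists [::]; split=> //; rewrite big_nil. Qed.

Lemma generatedD x y :
  generated M S x -> generated M S y -> generated M S (x + y).
Proof.
move=> [s [sS ->]] [r [rS ->]]; exists (s ++ r); rewrite big_cat; split=> // c.
by rewrite mem_cat => /orP[/sS|/rS].
Qed.

Lemma generatedZ a x : S x -> generated M S (a *: x).
Proof.
move=> Sx; exists [:: (a, x)]; rewrite big_seq1; split=> // c.
by rewrite inE => /eqP->.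
Qed.

End Generated.

(** * The Eulerian ideal and congruences between edge products *)

Section EulerianIdeal.

Variables (V : finType) (G : sgraph V) (K : fieldType).

Local Notation R := (edge_ring G K).
Local Notation I := (eulerian_idealr G K).
Implicit Types (J L B : {set edge G}) (m : 'X_{1..#|edge G|}).

Lemma mem_eulerian_ideal p : p \in I <-> eulerian_ideal p.
Proof. by split=> /asboolP. Qed.

Lemma generator_mem p :
  (@eulerian_binomials _ G K `|` @edge_squares _ G K)%classic p -> p \in I.
Proof.
move=> Sp; apply/mem_eulerian_ideal; exists [:: (1, p)].
by split=> [c|]; rewrite ?inE ?big_seq1 ?scale1r // => /eqP->.
Qed.

Lemma eq_residueP p q : residue p = residue q <-> p - q \in I.
Proof. by rewrite Quotient.idealrBE; split=> /eqP. Qed.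

Lemma residue_eq0P p : residue p = 0 <-> p \in I.
Proof. by rewrite -[p in p \in _]subr0 -eq_residueP /residue rmorph0. Qed.

Definition symdiff J L := (J :\: L) :|: (L :\: J).

Lemma edge_deg_sum J v :
  edge_deg J v = (\sum_(e : edge G) ((e \in J) && (v \in val e)))%N.
Proof.
rewrite /edge_deg -sum1_card big_mkcond; apply: eq_bigr => e _.
by rewrite inE; case: (_ && _).
Qed.

(** Modulo 2 the degree at [v] is a linear form in the indicator vector of the edge set, and
    symmetric difference is addition of indicator vectors. *)
Lemma odd_edge_deg_symdiff J L v :
  odd (edge_deg (symdiff J L) v) = odd (edge_deg J v) (+) odd (edge_deg L v).
Proof.
rewrite !edge_deg_sum -oddD -big_split /=.
rewrite !(big_morph odd oddD (erefl : odd 0 = false)).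
apply: eq_bigr => e _; rewrite oddD !oddb !inE.
by case: (e \in J); case: (e \in L); case: (v \in val e).
Qed.

Lemma eulerian_symdiffP J L :
  eulerian (symdiff J L) <->
  forall v, odd (edge_deg J v) = odd (edge_deg L v).
Proof.
split=> eJL v; have := eJL v; rewrite ?odd_edge_deg_symdiff.
  by case: (odd _); case: (odd _).
by move=> ->; rewrite addbb.
Qed.

Lemma edge_prodID J L :
  edge_prod K J = edge_prod K (J :&: L) * edge_prod K (J :\: L).
Proof. exact: big_setID. Qed.

(** The common edges factor out, leaving an Eulerian binomial on the disjoint sets [J :\: L] and
    [L :\: J]. *)
Lemma edge_prod_congr J L :
  #|J| = #|L| -> eulerian (symdiff J L) -> edge_prod K J - edge_prod K L \in I.
Proof.
move=> cJL eJL.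
have cD : #|J :\: L| = #|L :\: J|.
  by apply/eqP; rewrite -(eqn_add2l #|J :&: L|) cardsID finset.setIC cardsID cJL.
rewrite (edge_prodID J L) (edge_prodID L J) [L :&: J]finset.setIC -mulrBr.
apply: idealMr.
(* Eulerian binomials require non-empty sets; if one difference is empty, so is the other, and the
   two products coincide. *)
have [J0|J0] := eqVneq (J :\: L) finset.set0.
  have /eqP : #|L :\: J| = 0%N by rewrite -cD J0 cards0.
  by rewrite cards_eq0 J0 => /eqP->; rewrite subrr idealr0.
apply: generator_mem; left; exists (J :\: L), (L :\: J); split=> //; split=> //.
  by rewrite -cards_eq0 -cD cards_eq0.
by apply/setP => e; rewrite !inE; case: (e \in J); rewrite ?andbF.
Qed.

Lemma edge_var_sqr_mem e : edge_var K e ^+ 2 \in I.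
Proof. by apply: generator_mem; right; exists e. Qed.

Lemma edge_prod_sqr_mem J : J != finset.set0 -> edge_prod K J ^+ 2 \in I.
Proof.
case/finset.set0Pn => e eJ; rewrite /edge_prod (bigD1 e) //= exprMn mulrC.
exact/idealMr/edge_var_sqr_mem.
Qed.

(* Half of the Eulerian set [symdiff J B] can be chosen inside [J :\: B]; the
   binomial trading it for the other half turns [t_J] into a multiple of the
   square of the remaining part of [J :\: B]. *)
Lemma edge_prod_mem J B :
    (#|B| < #|J|)%N -> odd #|J| = odd #|B| -> eulerian (symdiff J B) ->
  edge_prod K J \in I.
Proof.
move=> ltBJ oJB eJB; rewrite (edge_prodID J B); apply: idealMr.
have := cardsID B J; have := cardsID J B; rewrite finset.setIC => cB cJ.
(* The sum is even because [#|J|] and [#|B|] have the same parity, and its half fits in [J :\: B]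
   because [B] is the smaller set. *)
have [|L sLJ cL] := @exists_subset_card _ (J :\: B) ((#|J :\: B| + #|B :\: J|)./2).
  by lia.
have cLD := cardsID L (J :\: B).
have JL : (J :\: B) :&: L = L by apply/finset.setIidPr.
rewrite JL in cLD; rewrite (edge_prodID (J :\: B) L) JL.
set D := (J :\: B) :\: L in cLD *; set B' := B :\: J in cB cL *.
have dBD : (B' :|: D) :\: D = B' /\ (B' :|: D) :&: D = D.
  by split; apply/setP => e; rewrite !inE; case: (e \in J); case: (e \in B);
    case: (e \in L).
have cBD := cardsID D (B' :|: D); rewrite dBD.1 dBD.2 in cBD.
have sub e : e \in L -> (e \in J) && (e \notin B).
  by move=> /(fintype.subsetP sLJ); rewrite inE andbC.
have sBD : symdiff L (B' :|: D) = symdiff J B.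
  apply/setP => e; rewrite !inE; have := sub e.
  by case: (e \in J); case: (e \in B); case: (e \in L) => //= /(_ isT).
have L_BD : edge_prod K L - edge_prod K (B' :|: D) \in I.
  by apply: edge_prod_congr; [lia | rewrite sBD].
rewrite -[edge_prod K L](subrK (edge_prod K (B' :|: D))) mulrDl.
apply: rpredD; first by rewrite mulrC idealMr.
rewrite (edge_prodID (B' :|: D) D) dBD.1 dBD.2 mulrC mulrA -expr2 mulrC.
(* [D] has half of [#|J :\: B| - #|B :\: J|] elements, a positive number since [#|B| < #|J|]. *)
apply/idealMr/edge_prod_sqr_mem; rewrite -cards_eq0; lia.
Qed.

(** * Exponent parities, squarefree monomials and the grading *)

Definition odd_edges m : {set edge G} := [set e | odd (m (enum_rank e))]%SET.

Lemma mpolyX_edge m :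
  'X_[m] = \prod_(e : edge G) edge_var K e ^+ m (enum_rank e).
Proof.
rewrite mpolyXE_id (reindex (@enum_rank (edge G))) //=.
by exists enum_val => e _; [exact: enum_rankK | exact: enum_valK].
Qed.

Lemma mdeg_edge m : mdeg m = (\sum_(e : edge G) m (enum_rank e))%N.
Proof.
rewrite mdegE (reindex (@enum_rank (edge G))) //=.
by exists enum_val => e _; [exact: enum_rankK | exact: enum_valK].
Qed.

Lemma card_odd_edges m : #|odd_edges m| = (\sum_(e : edge G) odd (m (enum_rank e)))%N.
Proof.
rewrite -sum1_card big_mkcond; apply: eq_bigr => e _.
by rewrite inE; case: odd.
Qed.

Definition squarefree m := [forall e : edge G, m (enum_rank e) <= 1]%N.

Lemma squarefree_odd m (e : edge G) :
  squarefree m -> m (enum_rank e) = odd (m (enum_rank e)).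
Proof. by move=> /forallP/(_ e); case: (m _) => [|[]]. Qed.

Lemma squarefreeX m : squarefree m -> 'X_[m] = edge_prod K (odd_edges m).
Proof.
move=> sm; rewrite mpolyX_edge /edge_prod [RHS]big_mkcond; apply: eq_bigr => e _.
by rewrite (squarefree_odd e sm) inE; case: odd.
Qed.

Lemma squarefree_mdeg m : squarefree m -> mdeg m = #|odd_edges m|.
Proof.
move=> sm; rewrite mdeg_edge card_odd_edges; apply: eq_bigr => e _.
exact: squarefree_odd.
Qed.

Lemma odd_card_odd_edges m : odd #|odd_edges m| = odd (mdeg m).
Proof.
rewrite mdeg_edge card_odd_edges !(big_morph odd oddD (erefl : odd 0 = false)).
by apply: eq_bigr => e _; rewrite oddb.
Qed.

(** Every exponent dominates its parity bit, strictly so when it is at least 2. *)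
Lemma nonsquarefree_mdeg m : ~~ squarefree m -> (#|odd_edges m| < mdeg m)%N.
Proof.
case/forallPn=> e me; rewrite mdeg_edge card_odd_edges (bigD1 e) //=.
rewrite [ltnRHS](bigD1 e) //= -addSn leq_add ?leq_sum // => [|i _].
  by rewrite -ltnNge in me; exact: leq_ltn_trans (leq_b1 _) me.
by case: (m _) => //= x; case: odd.
Qed.

Lemma nonsquarefreeX_mem m : ~~ squarefree m -> 'X_[m] \in I.
Proof.
case/forallPn=> e me; rewrite mpolyX_edge (bigD1 e) //= mulrC.
have -> : m (enum_rank e) = (m (enum_rank e) - 2 + 2)%N by lia.
by rewrite exprD; do 2!apply: idealMr; exact: edge_var_sqr_mem.
Qed.

(** An edge of even multiplicity adds an even amount to each vertex degree, so [odd_edges m] already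
    carries the vertex parities of the whole multigraph. *)
Definition edge_key m : nat * {ffun V -> bool} :=
  (mdeg m, [ffun v => odd (edge_deg (odd_edges m) v)]).

Lemma edge_keyP m1 m2 :
  edge_key m1 = edge_key m2 <->
  mdeg m1 = mdeg m2 /\ eulerian (symdiff (odd_edges m1) (odd_edges m2)).
Proof.
rewrite eulerian_symdiffP; split=> [[-> /ffunP e12]|[e12 o12]].
  by split=> // v; have := e12 v; rewrite !ffunE.
by congr (_, _) => //; apply/ffunP => v; rewrite !ffunE.
Qed.

Lemma odd_edgesD m1 m2 :
  odd_edges (m1 + m2)%MM = symdiff (odd_edges m1) (odd_edges m2).
Proof.
by apply/setP => e; rewrite !inE mnmDE oddD; case: (odd _); case: (odd _).
Qed.

(** Both components are additive, with values in the naturals and in vectors modulo 2, where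
    addition is cancellative. This is the hypothesis of [fiber_partXM]. *)
Lemma edge_keyD a m1 m2 :
  (edge_key (a + m1)%MM == edge_key (a + m2)%MM) = (edge_key m1 == edge_key m2).
Proof.
rewrite /edge_key !xpair_eqE !mdegD eqn_add2l; congr (_ && _).
apply/eqP/eqP => /ffunP e12; apply/ffunP => v; move: (e12 v);
  rewrite !ffunE !odd_edgesD !odd_edge_deg_symdiff; first exact: addbI.
by move->.
Qed.

(** The set [odd_edges m2] has fewer elements than the common degree, which is [#|odd_edges m1|],
    and the same parity, so it can serve as the smaller set in [edge_prod_mem]. *)
Lemma edge_key_squarefree_mem m1 m2 :
    edge_key m1 = edge_key m2 -> squarefree m1 -> ~~ squarefree m2 ->
  'X_[m1] \in I.
Proof.
move=> /edge_keyP[d12 e12] s1 /nonsquarefree_mdeg s2; rewrite squarefreeX //.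
apply: edge_prod_mem e12; first by rewrite -(squarefree_mdeg s1) d12.
by rewrite !odd_card_odd_edges d12.
Qed.

(** Two squarefree monomials are related by [edge_prod_congr]; as soon as one of the two is not
    squarefree, both lie in the ideal. *)
Lemma edge_key_congr m1 m2 :
  edge_key m1 = edge_key m2 -> 'X_[m1] - 'X_[m2] \in I.
Proof.
move=> e12; have [s1|s1] := boolP (squarefree m1).
  have [s2|s2] := boolP (squarefree m2).
    have [d12 o12] := (edge_keyP _ _).1 e12.
    by rewrite !squarefreeX // edge_prod_congr // -!squarefree_mdeg.
  apply: rpredB; last exact: nonsquarefreeX_mem.
  exact: edge_key_squarefree_mem e12 s1 s2.
apply: rpredB; first exact: nonsquarefreeX_mem.
have [s2|] := boolP (squarefree m2); last exact: nonsquarefreeX_mem.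
exact: edge_key_squarefree_mem (esym e12) s2 s1.
Qed.

(** * Homogeneity of the Eulerian ideal *)

Lemma edge_prodX J :
  exists m, [/\ edge_prod K J = 'X_[m], mdeg m = #|J| & odd_edges m = J].
Proof.
pose m := [multinom (enum_val i \in J : nat) | i < #|edge G|].
have mE e : m (enum_rank e) = (e \in J) by rewrite mnmE enum_rankK.
have oJ : odd_edges m = J by apply/setP => e; rewrite inE mE oddb.
have sm : squarefree m by apply/forallP => e; rewrite mE; case: (_ \in _).
by exists m; rewrite squarefreeX ?squarefree_mdeg ?oJ.
Qed.

(** A monomial multiple of a generator is homogeneous, the two terms of a binomial having equal
    keys, so its component is either all of it or zero. *)
Lemma fiber_part_generator_mem c a g :
    (@eulerian_binomials _ G K `|` @edge_squares _ G K)%classic g ->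
  fiber_part edge_key c ('X_[a] * g) \in I.
Proof.
move=> Sg; have g_I := generator_mem Sg.
case: Sg => [[J [L [[_ _ JL0 cJL eJL] gE]]]|[e _ gE]].
  have [mJ [JX dJ oJ]] := edge_prodX J; have [mL [LX dL oL]] := edge_prodX L.
  have /eqP : edge_key mJ = edge_key mL.
    apply/edge_keyP; rewrite dJ dL oJ oL; split=> //.
    suff -> : symdiff J L = J :|: L by [].
    apply/setP => e; have /setP/(_ e) := JL0; rewrite !inE.
    by case: (e \in J); case: (e \in L).
  rewrite gE JX LX in g_I *; rewrite -(edge_keyD a) => /eqP eJLa.
  rewrite mulrBr -!mpolyXD raddfB /= !fiber_partX eJLa.
  by case: ifP => _; rewrite ?subrr ?idealr0 // !mpolyXD -mulrBr idealMr.
rewrite -gE /edge_var mpolyXn in g_I *; rewrite -mpolyXD fiber_partX mpolyXD.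
by case: ifP => _; rewrite ?idealr0 ?idealMr.
Qed.

Lemma fiber_part_mem c p : p \in I -> fiber_part edge_key c p \in I.
Proof.
move=> /mem_eulerian_ideal[s [sS ->]]; rewrite raddf_sum big_seq.
apply: rpred_sum => -[a g] /sS /= Sg; rewrite -[_ *: _]/(a * g).
(* Expanding the coefficient [a] reduces the claim to monomial multiples of the generator [g]. *)
rewrite [a]mpolyE mulr_suml raddf_sum rpred_sum //= => m _.
rewrite -scalerAl linearZ /= -mul_mpolyC idealMr //.
exact: fiber_part_generator_mem.
Qed.

(** * Graded components of socle elements *)

Lemma scale_residue p q : p *: residue q = residue (p * q) :> eulerian_algebra G K.
Proof. by rewrite /residue rmorphM. Qed.

Lemma socle_residueP p :
  socle (eulerian_algebra G K) (residue p) <->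
  forall i, 'X_i * p \in I.
Proof.
split=> [sp i|Xp q [s [sX ->]]].
  apply/residue_eq0P; rewrite -scale_residue; apply: sp.
  rewrite -['X_i]mul1r; apply: (@generatedZ R R^o).
  by exists i.
rewrite scale_residue; apply/residue_eq0P; rewrite mulr_suml big_seq.
apply: rpred_sum => -[a g] /sX[i _ /= <-].
by rewrite -[_ *: _]/(a * 'X_i) -mulrA idealMr.
Qed.

(** A variable times a component of [p] is a component of ['X_i * p], which stays in the ideal by
    homogeneity. *)
Lemma socle_residue_fiber_part m p :
  socle (eulerian_algebra G K) (residue p) ->
  socle (eulerian_algebra G K) (residue (fiber_part edge_key (edge_key m) p)).
Proof.
move=> /socle_residueP sp; apply/socle_residueP => i.
by rewrite -fiber_partXM => [|m1 m2]; [exact: fiber_part_mem | exact: edge_keyD].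
Qed.

Lemma residue_fiber_part m p :
  exists a : K,
    residue (fiber_part edge_key (edge_key m) p) = residue (a%:MP * 'X_[m]).
Proof.
(* All monomials of the component are congruent to ['X_[m]], so their coefficients add up. *)
exists (\sum_(m' <- msupp p | edge_key m' == edge_key m) p@_m').
apply/eq_residueP; rewrite raddf_sum mulr_suml -sumrB.
apply: rpred_sum => m' /eqP mm'; rewrite -mul_mpolyC -mulrBr.
exact/idealMr/edge_key_congr.
Qed.

Lemma generated_residue_fiber_part m p :
  socle (eulerian_algebra G K) (residue p) ->
  generated (eulerian_algebra G K)
    [set residue ('X_[m'] : R) | m' in
      [set m' | socle (eulerian_algebra G K) (residue 'X_[m'])]]%classic
    (residue (fiber_part edge_key (edge_key m) p)).
Proof.
move=> /(socle_residue_fiber_part m); have [a ->] := residue_fiber_part m p.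
(* A non-zero scalar [a] is invertible, so the residue of ['X_[m]] itself lies in the socle. *)
have [->|a0] := eqVneq a 0.
  by rewrite mpolyC0 mul0r /residue rmorph0 => _; exact: generated0.
rewrite -scale_residue => sm; apply: generatedZ; exists m => //= q qX.
have /(congr1 (fun u => (a^-1)%:MP *: u)) := sm _ qX.
by rewrite scaler0 !scalerA mulrAC -mpolyCM mulVf // mpolyC1 mul1r.
Qed.

End EulerianIdeal.

(** * Generation of the socle by monomial residues *)

Local Open Scope classical_set_scope.

Theorem theorem3p1 (V : finType) (G : sgraph V) (hE : edges G != finset.set0)
    (K : fieldType) :
  exists S : set 'X_{1..#|edge G|},
    socle (eulerian_algebra G K) =
    generated (eulerian_algebra G K)
      [set residue ('X_[m] : edge_ring G K) | m in S].
Proof.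
(* This is the largest possible choice; that it generates no more than the socle follows from
   closure of the socle under linear combinations. *)
exists [set m | socle (eulerian_algebra G K) (residue 'X_[m])].
apply/seteqP; split=> [u|u [s [sS ->]] p pX]; last first.
  rewrite scaler_sumr big_seq big1 // => -[a v] /sS[m sm /= <-].
  by rewrite scalerA mulrC -scalerA sm // scaler0.
rewrite -[u]reprK -/(residue _); move: (repr u) => p sp.
rewrite [in residue p](fiber_part_sum (@edge_key _ G) p).
rewrite /residue rmorph_sum big_seq; apply: big_ind => [||c].
- exact: generated0.
- by move=> x y; exact: generatedD.
- by rewrite mem_undup => /mapP[m _ ->]; exact: generated_residue_fiber_part.
Qed.
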